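(* Let $X$ be a locally compact, $\sigma$-compact Hausdorff space such that there are infinitely many pairwise disjoint closed connected subsets $Y_n$ ($n\in\mathbb{N}$) of $X$, none of them compact, such that every compact subset of $X$ intersects only finitely many of the $Y_n$. Then the corona algebra $\mathcal{Q}(C_0(X))\cong C_b(X)/C_0(X)$ is not countably quantifier-free saturated.
   Context: $C_b(X)$ denotes the bounded continuous complex-valued functions on $X$; the corona algebra of $C_0(X)$ is $\mathcal{M}(C_0(X))/C_0(X)\cong C_b(X)/C_0(X)$. A $\mathrm{C}^*$-algebra $A$ (as a metric structure in continuous logic) is countably quantifier-free saturated if every countable set of quantifier-free conditions $\varphi(\bar x,\bar a)=r$ with parameters from $A$ which is finitely approximately satisfiable in $A$ (every finite subset is satisfiable up to any $\varepsilon>0$) is realized exactly by some tuple of $A$. *)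

(* Defs.v *)
From HB Require Import structures.
From mathcomp Require Import all_boot all_order all_algebra generic_quotient.
From mathcomp Require Import ring_quotient complex.
From mathcomp Require Import all_classical all_reals topology normedtype.
From mathcomp Require Import sequences ring lra.

Set Implicit Arguments.
Unset Strict Implicit.
Unset Printing Implicit Defensive.

Import Order.TTheory GRing.Theory Num.Theory.
Import numFieldNormedType.Exports.
Import ComplexField.Normc.

Local Open Scope classical_set_scope.
Local Open Scope ring_scope.
Local Open Scope quotient_scope.

(* `|z| is a complex number in R[i]; cmod z is the same modulus as a real. *)
Definition cmod (R : realType) (z : R[i]) : R := normc z.

(* Not necessarily unital. *)
Record cstarAlgebra (R : realType) := CStarAlgebra {
  cstar_sort :> lmodType R[i];
  cstar_mul : cstar_sort -> cstar_sort -> cstar_sort;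
  cstar_star : cstar_sort -> cstar_sort;
  cstar_norm : cstar_sort -> R;
  cstar_mulA : associative cstar_mul;
  cstar_mulDl : left_distributive cstar_mul +%R;
  cstar_mulDr : right_distributive cstar_mul +%R;
  cstar_mulZl : forall c a b, cstar_mul (c *: a) b = c *: cstar_mul a b;
  cstar_mulZr : forall c a b, cstar_mul a (c *: b) = c *: cstar_mul a b;
  cstar_starK : involutive cstar_star;
  cstar_starD : {morph cstar_star : a b / a + b};
  cstar_starZ : forall c a, cstar_star (c *: a) = conjc c *: cstar_star a;
  cstar_starM : forall a b,
    cstar_star (cstar_mul a b) = cstar_mul (cstar_star b) (cstar_star a);
  cstar_norm_ge0 : forall a, 0 <= cstar_norm a;
  cstar_norm0_eq0 : forall a, cstar_norm a = 0 -> a = 0;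
  cstar_normD : forall a b, cstar_norm (a + b) <= cstar_norm a + cstar_norm b;
  cstar_normZ : forall c a, cstar_norm (c *: a) = cmod c * cstar_norm a;
  cstar_normM : forall a b,
    cstar_norm (cstar_mul a b) <= cstar_norm a * cstar_norm b;
  cstar_norm_star : forall a,
    cstar_norm (cstar_mul (cstar_star a) a) = cstar_norm a ^+ 2;
  cstar_complete : forall u : nat -> cstar_sort,
    (forall e : R, 0 < e -> exists N : nat, forall m n : nat,
      (N <= m)%N -> (N <= n)%N -> cstar_norm (u m - u n) <= e) ->
    exists l, forall e : R, 0 < e -> exists N : nat, forall n : nat,
      (N <= n)%N -> cstar_norm (u n - l) <= e
}.

Section ContinuousLogic.
Variables (R : realType) (A : cstarAlgebra R).

(* Terms of the language of C*-algebras in the variables x_0, ..., x_(n-1),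
   with parameters from A, i.e. *-polynomials over A. *)
Inductive cstar_term (n : nat) : Type :=
| TVar of 'I_n
| TPar of A
| TAdd of cstar_term n & cstar_term n
| TScale of R[i] & cstar_term n
| TMul of cstar_term n & cstar_term n
| TStar of cstar_term n.

(* Atomic formulas are norms of terms (the metric is d(s, t) = |s - t|), and
   connectives are all continuous functions R^k -> R. *)
Inductive qf_formula (n : nat) : Type :=
| FNorm of cstar_term n
| FConn k (u : 'rV[R]_k -> R) of continuous u & ('I_k -> qf_formula n).

Fixpoint term_eval n (x : 'I_n -> A) (t : cstar_term n) : A :=
  match t with
  | TVar i => x i
  | TPar a => a
  | TAdd s t => term_eval x s + term_eval x t
  | TScale c t => c *: term_eval x t
  | TMul s t => cstar_mul (term_eval x s) (term_eval x t)
  | TStar t => cstar_star (term_eval x t)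
  end.

Fixpoint formula_eval n (x : 'I_n -> A) (phi : qf_formula n) : R :=
  match phi with
  | FNorm t => cstar_norm (term_eval x t)
  | FConn k u _ phis => u (\row_(j < k) formula_eval x (phis j))
  end.

(* As a metric structure, A is the union of the bounded sorts
   D_m = {a | |a| <= m}, and each variable x_i has a sort, here D_(d i). *)
Definition in_sorts n (d : 'I_n -> nat) (x : 'I_n -> A) : Prop :=
  forall i, cstar_norm (x i) <= (d i)%:R.

(* The pair (phi, r) stands for the condition phi = r. *)
Definition realizes n (d : 'I_n -> nat) (S : set (qf_formula n * R))
    (x : 'I_n -> A) : Prop :=
  in_sorts d x /\ forall c, S c -> formula_eval x c.1 = c.2.

Definition finitely_approx_satisfiable n (d : 'I_n -> nat)
    (S : set (qf_formula n * R)) : Prop :=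
  forall F : set (qf_formula n * R), F `<=` S -> finite_set F ->
  forall e : R, 0 < e ->
  exists2 x : 'I_n -> A, in_sorts d x &
    forall c, F c -> `|formula_eval x c.1 - c.2| <= e.

Definition countably_qf_saturated : Prop :=
  forall (n : nat) (d : 'I_n -> nat) (S : set (qf_formula n * R)),
    countable S -> finitely_approx_satisfiable d S ->
    exists x : 'I_n -> A, realizes d S x.

End ContinuousLogic.

Definition sigma_compact (X : topologicalType) : Prop :=
  exists2 K : nat -> set X, (forall n, compact (K n)) &
    \bigcup_n K n = [set: X].

Section Modulus.
Variable R : realType.
Implicit Types z w : R[i].

Lemma cmodE z : (cmod z)%:C%C = `|z|. Proof. by []. Qed.

Lemma cmod_ge0 z : 0 <= cmod z.
Proof. by case: z => a b; exact: sqrtr_ge0. Qed.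

Lemma cmod0 : cmod (0 : R[i]) = 0. Proof. exact: normc0. Qed.

Lemma cmod1 : cmod (1 : R[i]) = 1. Proof. exact: normc1. Qed.

Lemma cmod_eq0 z : cmod z = 0 -> z = 0. Proof. exact: eq0_normc. Qed.

Lemma cmodM z w : cmod (z * w) = cmod z * cmod w.
Proof. exact: normcM. Qed.

Lemma cmodD z w : cmod (z + w) <= cmod z + cmod w.
Proof. exact: le_normcD. Qed.

Lemma cmodN z : cmod (- z) = cmod z. Proof. exact: normcN. Qed.

Lemma cmodV z : cmod z^-1 = (cmod z)^-1. Proof. exact: normcV. Qed.

Lemma cmod_conj z : cmod (conjc z) = cmod z.
Proof. by case: z => a b; rewrite /cmod /= sqrrN. Qed.

Lemma cmod_real (r : R) : cmod r%:C%C = `|r|.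
Proof. by rewrite /cmod /= expr0n addr0 sqrtr_sqr. Qed.

Lemma cmodB z w : cmod (z - w) = cmod (w - z).
Proof. by rewrite -cmodN opprB. Qed.

Lemma ler_cmodB z w : `|cmod z - cmod w| <= cmod (z - w).
Proof.
have H (u v : R[i]) : cmod u - cmod v <= cmod (u - v).
  by rewrite lerBlDr; apply: le_trans (cmodD _ _); rewrite subrK.
by rewrite ler_norml H lerNl opprB cmodB H.
Qed.

Lemma Re_le_cmod z : `|complex.Re z| <= cmod z.
Proof.
by case: z => a b; rewrite /cmod/= -sqrtr_sqr ler_wsqrtr// lerDl sqr_ge0.
Qed.

Lemma Im_le_cmod z : `|complex.Im z| <= cmod z.
Proof.
by case: z => a b; rewrite /cmod/= -sqrtr_sqr ler_wsqrtr// lerDr sqr_ge0.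
Qed.

Lemma cmod_le_ReIm z : cmod z <= `|complex.Re z| + `|complex.Im z|.
Proof.
case: z => a b; have := cmodD a%:C%C (0 +i* b)%C; rewrite cmod_real.
have -> : cmod (0 +i* b)%C = `|b| by rewrite /cmod/= expr0n add0r sqrtr_sqr.
by simpc.
Qed.

End Modulus.

Section BoundedFunctions.
Variables (R : realType) (X : topologicalType).
Implicit Types (f g : X -> R[i]) (x : X).

(* R[i]^o carries the topology given by the modulus. *)
Definition Cb_pred : {pred X -> R[i]} :=
  [pred f | `[< continuous (f : X -> R[i]^o) /\
                exists M : R, forall x, cmod (f x) <= M >]].

Lemma continuous_cmodP f : continuous (f : X -> R[i]^o) <->
  forall x (e : R), 0 < e -> \forall y \near x, cmod (f x - f y) < e.
Proof.
split=> [cf x e e0|H x].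
  have /cvgrPdist_lt/(_ e%:C%C) := cf x; rewrite ltcR => /(_ e0).
  by apply: filterS => y; rewrite -ltcR.
apply/cvgrPdist_lt => -[a b]; rewrite ltcE/= => /andP[/eqP b0 a0].
by have := H x a a0; apply: filterS => y; rewrite ltcE/= b0 eqxx.
Qed.

Lemma Cb_subring : GRing.subring_closed Cb_pred.
Proof.
split.
- apply/asboolP; split; first exact: cst_continuous.
  by exists 1 => x; rewrite (_ : (1 : X -> R[i]) x = 1)// cmod1.
- move=> f g /asboolP[cf [M Mf]] /asboolP[cg [N Ng]]; apply/asboolP; split.
    by move=> x; apply: (@cvgB _ R[i]^o _ _ _ f g); [exact: cf|exact: cg].
  exists (M + N) => x; apply: (le_trans (cmodD _ _)).
  by rewrite cmodN lerD.
- move=> f g /asboolP[cf [M Mf]] /asboolP[cg [N Ng]]; apply/asboolP; split.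
    by move=> x; apply: (@cvgM R[i] _ _ _ f g); [exact: cf|exact: cg].
  by exists (M * N) => x; rewrite cmodM ler_pM// cmod_ge0.
Qed.

HB.instance Definition _ := GRing.isSubringClosed.Build _ Cb_pred Cb_subring.

Record Cb := MkCb { Cb_fun :> X -> R[i]; Cb_funP : Cb_fun \in Cb_pred }.

HB.instance Definition _ := [isSub for Cb_fun].
HB.instance Definition _ := [Choice of Cb by <:].
HB.instance Definition _ := 
  GRing.SubChoice_isSubComPzRing.Build _ _ Cb Cb_subring.

Lemma Cb_scaler_closed : GRing.scaler_closed Cb_pred.
Proof.
move=> c f fCb; rewrite (_ : c *: f = cst c * f)// rpredM//.
apply/asboolP; split; first exact: cst_continuous.
by exists (cmod c) => x.
Qed.

HB.instance Definition _ :=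
  GRing.isScaleClosed.Build R[i] (X -> R[i]) Cb_pred Cb_scaler_closed.
HB.instance Definition _ := [SubZmodule_isSubLmodule of Cb by <:].

Lemma Cb_bounded (f : Cb) : exists2 M : R, 0 < M & forall x, cmod (f x) <= M.
Proof.
case: f => f /= /asboolP[_ [M Mf]]; exists (`|M| + 1) => [|x].
  by rewrite ltr_wpDl.
by rewrite (le_trans (Mf x))// (le_trans (ler_norm M))// lerDl.
Qed.

Lemma Cb_continuous (f : Cb) x (e : R) :
  0 < e -> \forall y \near x, cmod (f x - f y) < e.
Proof. by case: f => f /= /asboolP[/continuous_cmodP + _]; exact. Qed.

Lemma CbP f : (forall x (e : R), 0 < e -> \forall y \near x, cmod (f x - f y) < e) ->
  (exists M : R, forall x, cmod (f x) <= M) -> f \in Cb_pred.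
Proof. by move=> cf bf; apply/asboolP; split=> //; exact/continuous_cmodP. Qed.

Lemma CbDE (f g : Cb) x : (f + g) x = f x + g x. Proof. by []. Qed.
Lemma CbNE (f : Cb) x : (- f) x = - f x. Proof. by []. Qed.
Lemma CbME (f g : Cb) x : (f * g) x = f x * g x. Proof. by []. Qed.
Lemma CbZE c (f : Cb) x : (c *: f) x = c * f x. Proof. by []. Qed.
Lemma Cb1E x : (1 : Cb) x = 1. Proof. by []. Qed.
Lemma Cb0E x : (0 : Cb) x = 0. Proof. by []. Qed.

Lemma Cb_eq (f g : Cb) : (forall x, f x = g x) -> f = g.
Proof. by move=> fg; apply/val_inj/funext. Qed.

Lemma Cb_conj_subproof (f : Cb) : (conjc \o f) \in Cb_pred.
Proof.
apply: CbP => [x e e0|].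
  have := Cb_continuous f x e0; apply: filterS => y /=.
  by rewrite -rmorphB cmod_conj.
by have [M _ Mf] := Cb_bounded f; exists M => x; rewrite /= cmod_conj.
Qed.

Definition Cb_conj (f : Cb) : Cb := MkCb (Cb_conj_subproof f).

Definition Cb_norm (f : Cb) : R := sup (range (fun x => cmod (f x))).

Definition C0_pred : {pred Cb} :=
  [pred f : Cb | `[< forall e : R, 0 < e ->
     exists2 K : set X, compact K & forall x, ~ K x -> cmod (f x) < e >]].

Lemma C0_zmod : GRing.zmod_closed C0_pred.
Proof.
split.
  apply/asboolP => e e0; exists set0; first exact: compact0.
  by move=> x _; rewrite Cb0E cmod0.
move=> f g /asboolP fC0 /asboolP gC0; apply/asboolP => e e0.
have e20 : 0 < e / 2 by rewrite divr_gt0.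
have [K cK fK] := fC0 _ e20; have [L cL gL] := gC0 _ e20.
exists (K `|` L); first exact: compactU.
move=> x /not_orP[/fK fx /gL gx]; rewrite CbDE CbNE.
by rewrite (le_lt_trans (cmodD _ _))// cmodN (splitr e) ltrD.
Qed.

HB.instance Definition _ := GRing.isZmodClosed.Build Cb C0_pred C0_zmod.

Lemma C0_mul (f g : Cb) : g \in C0_pred -> f * g \in C0_pred.
Proof.
move=> /asboolP gC0; apply/asboolP => e e0; have [M M0 Mf] := Cb_bounded f.
have [K cK gK] := gC0 _ (divr_gt0 e0 M0); exists K => // x /gK gx.
rewrite CbME cmodM (@le_lt_trans _ _ (M * cmod (g x)))//.
  by rewrite ler_wpM2r// cmod_ge0.
by rewrite mulrC -ltr_pdivlMr.
Qed.

Lemma C0_scale c (g : Cb) : g \in C0_pred -> c *: g \in C0_pred.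
Proof.
move=> gC0; rewrite (_ : c *: g = (c *: (1 : Cb) : Cb) * g) ?C0_mul//.
by apply: Cb_eq => x; rewrite CbME !CbZE Cb1E mulr1.
Qed.

Lemma C0_conj (f : Cb) : f \in C0_pred -> Cb_conj f \in C0_pred.
Proof.
move=> /asboolP fC0; apply/asboolP => e e0; have [K cK fK] := fC0 _ e0.
by exists K => // x /fK; rewrite /= cmod_conj.
Qed.

Definition corona_quot : Type := Quotient.quot C0_pred.
HB.instance Definition _ := GRing.Zmodule.on corona_quot.
HB.instance Definition _ := EqQuotient.on corona_quot.

Definition corona_pi (f : Cb) : corona_quot := \pi_(Quotient.quot C0_pred) f.

Lemma corona_piP (a : corona_quot) : exists f : Cb, corona_pi f = a.
Proof. by exists (repr a); rewrite /corona_pi reprK. Qed.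

Lemma corona_pi_eq (f g : Cb) :
  corona_pi f = corona_pi g <-> f - g \in C0_pred.
Proof. by rewrite Quotient.idealrBE; split=> [/eqP|/eqP]. Qed.

Lemma corona_piD : {morph corona_pi : f g / f + g}.
Proof. by move=> f g; exact: (Quotient.pi_add _). Qed.

Lemma corona_piN : {morph corona_pi : f / - f}.
Proof. by move=> f; exact: (Quotient.pi_opp _). Qed.

Definition corona_repr (a : corona_quot) : Cb := repr a.

Lemma corona_reprK a : corona_pi (corona_repr a) = a.
Proof. exact: reprK. Qed.

Definition corona_scale (c : R[i]) (a : corona_quot) : corona_quot :=
  corona_pi (c *: corona_repr a).

Definition corona_mul (a b : corona_quot) : corona_quot :=
  corona_pi (corona_repr a * corona_repr b).

Definition corona_star (a : corona_quot) : corona_quot :=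
  corona_pi (Cb_conj (corona_repr a)).

Definition corona_norm (a : corona_quot) : R :=
  inf [set Cb_norm f | f in [set f : Cb | corona_pi f = a]].

Lemma sub_repr_C0 (f : Cb) : f - corona_repr (corona_pi f) \in C0_pred.
Proof. by apply/corona_pi_eq; rewrite corona_reprK. Qed.

Lemma corona_piZ c (f : Cb) : corona_pi (c *: f) = corona_scale c (corona_pi f).
Proof. by apply/corona_pi_eq; rewrite -scalerBr C0_scale// sub_repr_C0. Qed.

Lemma corona_piM : {morph corona_pi : f g / f * g >-> corona_mul f g}.
Proof.
move=> f g; apply/corona_pi_eq; set f' := corona_repr _; set g' := corona_repr _.
rewrite (_ : _ - _ = f * (g - g') + g' * (f - f')).
  by rewrite rpredD// C0_mul// sub_repr_C0.
by rewrite !mulrBr addrA (mulrC g' f) subrK (mulrC g').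
Qed.

Lemma Cb_conjB (f g : Cb) : Cb_conj (f - g) = Cb_conj f - Cb_conj g.
Proof. by apply: Cb_eq => x; rewrite /= rmorphB. Qed.

Lemma corona_pi_star (f : Cb) : corona_pi (Cb_conj f) = corona_star (corona_pi f).
Proof. by apply/corona_pi_eq; rewrite -Cb_conjB C0_conj// sub_repr_C0. Qed.

Let corona_scalerA c d a :
  corona_scale c (corona_scale d a) = corona_scale (c * d) a.
Proof.
by have [f <-] := corona_piP a; rewrite -!corona_piZ scalerA.
Qed.

Let corona_scale1r : left_id 1 corona_scale.
Proof. by move=> a; have [f <-] := corona_piP a; rewrite -corona_piZ scale1r. Qed.

Let corona_scalerDr : right_distributive corona_scale +%R.
Proof.
move=> c a b; have [f <-] := corona_piP a; have [g <-] := corona_piP b.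
by rewrite -corona_piD -!corona_piZ scalerDr corona_piD.
Qed.

Let corona_scalerDl a : {morph corona_scale^~ a : c d / c + d}.
Proof.
by have [f <-] := corona_piP a => c d; rewrite -!corona_piZ scalerDl corona_piD.
Qed.

HB.instance Definition _ := GRing.Zmodule_isLmodule.Build R[i] corona_quot
  corona_scalerA corona_scale1r corona_scalerDr corona_scalerDl.

Lemma corona_piZE c (f : Cb) : corona_pi (c *: f) = c *: corona_pi f.
Proof. exact: corona_piZ. Qed.

Lemma corona_mulA : associative corona_mul.
Proof.
move=> a b c; have [f <-] := corona_piP a; have [g <-] := corona_piP b.
by have [h <-] := corona_piP c; rewrite -!corona_piM mulrA.
Qed.

Lemma corona_mulC : commutative corona_mul.
Proof.
move=> a b; have [f <-] := corona_piP a; have [g <-] := corona_piP b.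
by rewrite -!corona_piM mulrC.
Qed.

Lemma corona_mulDl : left_distributive corona_mul +%R.
Proof.
move=> a b c; have [f <-] := corona_piP a; have [g <-] := corona_piP b.
by have [h <-] := corona_piP c; rewrite -corona_piD -!corona_piM mulrDl corona_piD.
Qed.

Lemma corona_mulDr : right_distributive corona_mul +%R.
Proof. by move=> a b c; rewrite corona_mulC corona_mulDl !(corona_mulC a). Qed.

Lemma corona_mulZl c a b : corona_mul (c *: a) b = c *: corona_mul a b.
Proof.
have [f <-] := corona_piP a; have [g <-] := corona_piP b.
rewrite -corona_piZE -!corona_piM -corona_piZE; congr corona_pi.
by apply: Cb_eq => x; rewrite CbZE !CbME CbZE mulrA.
Qed.

Lemma corona_mulZr c a b : corona_mul a (c *: b) = c *: corona_mul a b.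
Proof. by rewrite corona_mulC corona_mulZl corona_mulC. Qed.

Lemma corona_starK : involutive corona_star.
Proof.
move=> a; have [f <-] := corona_piP a; rewrite -!corona_pi_star.
by congr corona_pi; apply: Cb_eq => x; rewrite /= conjcK.
Qed.

Lemma corona_starD : {morph corona_star : a b / a + b}.
Proof.
move=> a b; have [f <-] := corona_piP a; have [g <-] := corona_piP b.
rewrite -corona_piD -!corona_pi_star -corona_piD.
by congr corona_pi; apply: Cb_eq => x; rewrite /= rmorphD.
Qed.

Lemma corona_starZ c a : corona_star (c *: a) = conjc c *: corona_star a.
Proof.
have [f <-] := corona_piP a; rewrite -corona_piZE -!corona_pi_star -corona_piZE.
by congr corona_pi; apply: Cb_eq => x; rewrite /= rmorphM.
Qed.

Lemma corona_starM a b :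
  corona_star (corona_mul a b) = corona_mul (corona_star b) (corona_star a).
Proof.
have [f <-] := corona_piP a; have [g <-] := corona_piP b.
rewrite -corona_piM -!corona_pi_star -corona_piM.
by congr corona_pi; apply: Cb_eq => x; rewrite /= rmorphM mulrC.
Qed.

Lemma Cb_norm_ub (f : Cb) x : cmod (f x) <= Cb_norm f.
Proof.
apply: sup_upper_bound; last by exists x.
split; first by exists (cmod (f x)); exists x.
by have [M _ Mf] := Cb_bounded f; exists M => _ [y _ <-].
Qed.

Lemma Cb_norm_le (f : Cb) (M : R) :
  0 <= M -> (forall x, cmod (f x) <= M) -> Cb_norm f <= M.
Proof.
move=> M0 Mf; have [e|/set0P ne] := eqVneq (range (fun x => cmod (f x))) set0.
  by rewrite /Cb_norm e sup0.
by apply: ge_sup => // _ [x _ <-].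
Qed.

Lemma Cb_norm_ge0 (f : Cb) : 0 <= Cb_norm f.
Proof.
have [e|/set0P[_ [x _ _]]] := eqVneq (range (fun x => cmod (f x))) set0.
  by rewrite /Cb_norm e sup0.
exact: le_trans (cmod_ge0 _) (Cb_norm_ub f x).
Qed.

Lemma corona_norm_has_inf a :
  has_inf [set Cb_norm f | f in [set f : Cb | corona_pi f = a]].
Proof.
split; first by have [f fa] := corona_piP a; exists (Cb_norm f); exists f.
by exists 0 => _ [f _ <-]; exact: Cb_norm_ge0.
Qed.

Lemma corona_norm_ge0 a : 0 <= corona_norm a.
Proof.
apply: lb_le_inf; first by have [] := corona_norm_has_inf a.
by move=> _ [f _ <-]; exact: Cb_norm_ge0.
Qed.

Lemma corona_norm_lift a (e : R) : 0 < e ->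
  exists2 f : Cb, corona_pi f = a & Cb_norm f < corona_norm a + e.
Proof.
move=> e0; have [_ [f fa <-] h] := inf_adherent e0 (corona_norm_has_inf a).
by exists f.
Qed.

Lemma corona_norm_le_lift (f : Cb) : corona_norm (corona_pi f) <= Cb_norm f.
Proof. by apply: ge_inf; [have [] := corona_norm_has_inf (corona_pi f)|exists f]. Qed.

Let clamp (s : R) (f : Cb) x : R[i] := (s / Num.max s (cmod (f x)))%:C%C * f x.

Lemma clamp_Cb (s : R) (f : Cb) : 0 < s -> clamp s f \in Cb_pred.
Proof.
move=> s0; have [M M0 Mf] := Cb_bounded f; apply/asboolP; split; last first.
  exists M => x; rewrite cmodM cmod_real.
  have m0 : 0 < Num.max s (cmod (f x)) by rewrite lt_max s0.
  rewrite ger0_norm; last by rewrite divr_ge0// ltW.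
  rewrite (le_trans _ (Mf x))//.
  by rewrite ler_piMl ?cmod_ge0// ler_pdivrMr// mul1r le_max lexx.
have cf : continuous (Cb_fun f : X -> R[i]^o) by case: f {Mf} => f /= /asboolP[].
move=> x; apply: (@cvgM R[i] _ _ _ (fun x => (s / Num.max s (cmod (f x)))%:C%C) f);
  last exact: cf.
have h : (s / Num.max s (cmod (f y))) @[y --> x] --> s / Num.max s (cmod (f x)).
  apply: cvgM; first exact: cvg_cst.
  apply: cvgV; first by rewrite gt_eqF// lt_max s0.
  apply: (continuous_max (f := cst s) (g := fun y => cmod (f y)));
    first exact: cvg_cst.
  apply/cvgrPdist_lt => e e0; have := Cb_continuous f x e0.
  by apply: filterS => y; apply: le_lt_trans; exact: ler_cmodB.
apply/cvgrPdist_lt => -[a b]; rewrite ltcE/= => /andP[/eqP b0 a0].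
have /cvgrPdist_lt/(_ _ a0) := h; apply: filterS => y.
rewrite -rmorphB => hy; rewrite -cmodE cmod_real b0.
by rewrite ltcE /= eqxx.
Qed.

Lemma corona_norm_leP (f : Cb) (t : R) : 0 <= t ->
  corona_norm (corona_pi f) <= t <->
  forall e : R, 0 < e ->
    exists2 K : set X, compact K & forall x, ~ K x -> cmod (f x) <= t + e.
Proof.
move=> t0; split=> [ft e e0|H].
  have e20 : 0 < e / 2 by rewrite divr_gt0.
  have [g /esym /corona_pi_eq /asboolP /(_ _ e20)[K cK fgK] gt] :=
    corona_norm_lift (corona_pi f) e20.
  exists K => // x /fgK fgx; rewrite -[f x](subrK (g x)).
  rewrite (le_trans (cmodD _ _))// addrC (splitr e) addrA lerD//; last exact: ltW.
  by rewrite (le_trans (Cb_norm_ub g x))// (le_trans (ltW gt))// lerD2r.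
apply/ler_addgt0Pl => e e0; rewrite addrC.
have s0 : 0 < t + e by rewrite ltr_wpDl.
have [K cK fK] := H _ e0.
pose g : Cb := MkCb (clamp_Cb f s0).
have -> : corona_pi f = corona_pi g.
  apply/corona_pi_eq/asboolP => d d0; exists K => // x /fK fx.
  rewrite CbDE CbNE /= /clamp max_l// divff ?gt_eqF// mul1r subrr.
  by rewrite cmod0.
rewrite (le_trans (corona_norm_le_lift g))// Cb_norm_le ?ltW// => x.
rewrite /= /clamp cmodM cmod_real.
have m0 : 0 < Num.max (t + e) (cmod (f x)) by rewrite lt_max s0.
rewrite ger0_norm; last by rewrite divr_ge0// ltW.
rewrite mulrAC ler_pdivrMr//.
by rewrite ler_pM2l// le_max lexx orbT.
Qed.

Lemma corona_norm0_eq0 a : corona_norm a = 0 -> a = 0.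
Proof.
have [f <-] := corona_piP a => f0.
have : corona_norm (corona_pi f) <= 0 by rewrite f0.
move=> /(corona_norm_leP f (lexx 0)) H.
have -> : 0 = corona_pi 0 by rewrite -(subrr (0 : Cb)) corona_piD corona_piN subrr.
apply/corona_pi_eq/asboolP => e e0.
have [K cK fK] := H _ (divr_gt0 e0 (ltr0n _ 2)); exists K => // x /fK.
rewrite subr0 add0r => /le_lt_trans; apply.
by rewrite ltr_pdivrMr// ltr_pMr// ltr1n.
Qed.

Lemma corona_normD a b : corona_norm (a + b) <= corona_norm a + corona_norm b.
Proof.
apply/ler_addgt0Pl => e e0; have e20 : 0 < e / 2 by rewrite divr_gt0.
have [f <- fe] := corona_norm_lift a e20.
have [g <- ge] := corona_norm_lift b e20.
rewrite -corona_piD (le_trans (corona_norm_le_lift _))//.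
apply: (@le_trans _ _ (Cb_norm f + Cb_norm g)).
  apply: Cb_norm_le => [|x]; first by rewrite addr_ge0 ?Cb_norm_ge0.
  by rewrite CbDE (le_trans (cmodD _ _))// lerD// Cb_norm_ub.
by rewrite (le_trans (lerD (ltW fe) (ltW ge)))// addrACA -splitr addrC.
Qed.

Lemma corona_normZ_le c a : corona_norm (c *: a) <= cmod c * corona_norm a.
Proof.
apply/ler_addgt0Pl => e e0.
have c0 : 0 < cmod c + 1 by rewrite ltr_wpDl// cmod_ge0.
have [f <- fe] := corona_norm_lift a (divr_gt0 e0 c0).
rewrite -corona_piZE (le_trans (corona_norm_le_lift _))//.
apply: (@le_trans _ _ (cmod c * Cb_norm f)).
  apply: Cb_norm_le => [|x]; first by rewrite mulr_ge0 ?cmod_ge0 ?Cb_norm_ge0.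
  by rewrite CbZE cmodM ler_wpM2l ?cmod_ge0// Cb_norm_ub.
rewrite (le_trans (ler_wpM2l (cmod_ge0 _) (ltW fe)))// mulrDr addrC lerD2r.
rewrite mulrCA; apply: ler_piMr; first exact: ltW.
by rewrite ler_pdivrMr// mul1r lerDl.
Qed.

Lemma corona_normZ c a : corona_norm (c *: a) = cmod c * corona_norm a.
Proof.
apply/le_anti; rewrite corona_normZ_le/=.
have [->|c0] := eqVneq c 0; first by rewrite cmod0 mul0r corona_norm_ge0.
have c0' : 0 < cmod c.
  rewrite lt_neqAle cmod_ge0 andbT eq_sym; apply: contra c0 => /eqP/cmod_eq0 ->.
  exact: eqxx.
rewrite -ler_pdivlMl// -{1}[a](scale1r a) -(mulVf c0) -scalerA.
by rewrite (le_trans (corona_normZ_le _ _))// cmodV.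
Qed.

Lemma corona_norm_starE a : corona_norm (corona_star a) = corona_norm a.
Proof.
have H b : corona_norm (corona_star b) <= corona_norm b.
  apply/ler_addgt0Pl => e e0; have [f <- fe] := corona_norm_lift b e0.
  rewrite -corona_pi_star (le_trans (corona_norm_le_lift _))//.
  rewrite [leRHS]addrC (le_trans _ (ltW fe))//.
  apply: Cb_norm_le => [|x]; first exact: Cb_norm_ge0.
  by rewrite /= cmod_conj Cb_norm_ub.
by apply/le_anti; rewrite H/= -{1}(corona_starK a) H.
Qed.

Lemma corona_normM a b :
  corona_norm (corona_mul a b) <= corona_norm a * corona_norm b.
Proof.
set s := corona_norm a; set t := corona_norm b.
have st0 : 0 < s + t + 1 by rewrite ltr_wpDl// addr_ge0 ?corona_norm_ge0.
apply/ler_addgt0Pl => e e0; pose d := Num.min 1 (e / (s + t + 1)).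
have d0 : 0 < d by rewrite lt_min ltr01 divr_gt0.
have [f fa fe] := corona_norm_lift a d0.
have [g gb ge] := corona_norm_lift b d0.
rewrite -{1}fa -{1}gb -corona_piM (le_trans (corona_norm_le_lift _))//.
apply: (@le_trans _ _ (Cb_norm f * Cb_norm g)).
  apply: Cb_norm_le => [|x]; first by rewrite mulr_ge0 ?Cb_norm_ge0.
  by rewrite CbME cmodM ler_pM ?cmod_ge0// Cb_norm_ub.
rewrite (le_trans (ler_pM (Cb_norm_ge0 _) (Cb_norm_ge0 _) (ltW fe) (ltW ge)))//.
have d1 : d <= 1 by rewrite ge_min lexx.
have de : d * (s + t + 1) <= e.
  by rewrite -ler_pdivlMr// ge_min lexx orbT.
have dd : d * d <= d by rewrite ler_piMr// ltW.
rewrite -/s -/t; have -> : (s + d) * (t + d) = s * t + d * (s + t) + d * d by ring.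
by move: de; rewrite mulrDr mulr1; lra.
Qed.

Lemma corona_norm_cstar a :
  corona_norm (corona_mul (corona_star a) a) = corona_norm a ^+ 2.
Proof.
apply/le_anti/andP; split.
  by rewrite (le_trans (corona_normM _ _))// corona_norm_starE expr2.
have [f <-] := corona_piP a; rewrite -corona_pi_star -corona_piM.
set t := corona_norm (corona_pi (_ * _)).
have t0 : 0 <= t by exact: corona_norm_ge0.
rewrite -[t]sqr_sqrtr// ler_sqr ?nnegrE ?corona_norm_ge0 ?sqrtr_ge0//.
have /(corona_norm_leP _ t0) H := lexx t.
apply/corona_norm_leP => [|e e0]; first exact: sqrtr_ge0.
have [K cK fK] := H _ (exprn_gt0 2 e0); exists K => // x /fK.
rewrite CbME cmodM (_ : Cb_conj f x = conjc (f x))// cmod_conj -expr2 => fx.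
have h0 : 0 <= Num.sqrt t + e by rewrite addr_ge0 ?sqrtr_ge0// ltW.
rewrite -(@ler_sqr R) ?nnegrE ?cmod_ge0//.
rewrite (le_trans fx)// sqrrD sqr_sqrtr// -addrA lerD2l lerDr.
by rewrite mulrn_wge0// mulr_ge0 ?sqrtr_ge0// ltW.
Qed.

Lemma Cb_complete (g : nat -> Cb) :
  (forall e : R, 0 < e -> exists N : nat, forall m n : nat,
    (N <= m)%N -> (N <= n)%N -> Cb_norm (g m - g n) <= e) ->
  exists l : Cb, forall e : R, 0 < e -> exists N : nat, forall n : nat,
    (N <= n)%N -> Cb_norm (g n - l) <= e.
Proof.
move=> gC.
have gCx (e : R) : 0 < e -> exists N : nat, forall m n : nat,
    (N <= m)%N -> (N <= n)%N -> forall x, cmod (g m x - g n x) <= e.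
  move=> e0; have [N gN] := gC _ e0; exists N => m n Nm Nn x.
  exact: le_trans (Cb_norm_ub (g m - g n) x) (gN _ _ Nm Nn).
have cvg_part (p : R[i] -> R) :
    (forall z w, p (z - w) = p z - p w) -> (forall z, `|p z| <= cmod z) ->
    forall x, cvgn (fun n => p (g n x)).
  move=> pB pz x; apply/cauchy_cvgP/cauchy_exP => e e0.
  have [N gN] := gCx _ (divr_gt0 e0 (ltr0n _ 2)).
  exists (p (g N x)); exists N => // n /= Nn; rewrite /ball/= -pB.
  rewrite (le_lt_trans (pz _))// (le_lt_trans (gN _ _ (leqnn N) Nn x))//.
  by rewrite ltr_pdivrMr// ltr_pMr// ltr1n.
have cvRe := cvg_part (@complex.Re R) (raddfB _) (@Re_le_cmod R).
have cvIm := cvg_part (@complex.Im R) (raddfB _) (@Im_le_cmod R).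
pose l x : R[i] := (limn (fun n => complex.Re (g n x)) +i*
                    limn (fun n => complex.Im (g n x)))%C.
have gl (e : R) : 0 < e -> exists N : nat, forall n : nat, (N <= n)%N ->
    forall x, cmod (g n x - l x) <= e.
  move=> e0; have e20 : 0 < e / 2 by rewrite divr_gt0.
  have [N gN] := gCx _ e20; exists N => n Nn x.
  apply: (le_trans (cmod_le_ReIm _)); rewrite (splitr e) !raddfB/= lerD//.
  - have h : (complex.Re (g n x) - complex.Re (g m x)) @[m --> \oo] -->
        complex.Re (g n x) - limn (fun m => complex.Re (g m x)).
      by apply: cvgB; [exact: cvg_cst|exact: cvRe].
    apply: (cvgr_to_le (cvg_norm h)); exists N => // m /= Nm.
    by rewrite -raddfB (le_trans (Re_le_cmod _))// gN.
  - have h : (complex.Im (g n x) - complex.Im (g m x)) @[m --> \oo] -->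
        complex.Im (g n x) - limn (fun m => complex.Im (g m x)).
      by apply: cvgB; [exact: cvg_cst|exact: cvIm].
    apply: (cvgr_to_le (cvg_norm h)); exists N => // m /= Nm.
    by rewrite -raddfB (le_trans (Im_le_cmod _))// gN.
have lCb : l \in Cb_pred.
  apply: CbP => [x e e0|].
    have e30 : 0 < e / 3 by rewrite divr_gt0.
    have [N gN] := gl _ e30.
    have := Cb_continuous (g N) x e30; apply: filterS => y gxy.
    have -> : l x - l y = (g N x - g N y) + (g N y - l y) - (g N x - l x).
      by ring.
    have h1 := gN N (leqnn N) x; have h2 := gN N (leqnn N) y.
    have h3 := cmodD (g N x - g N y + (g N y - l y)) (- (g N x - l x)).
    have h4 := cmodD (g N x - g N y) (g N y - l y).
    by move: h3; rewrite cmodN; lra.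
  have [N gN] := gl _ ltr01; have [M M0 gM] := Cb_bounded (g N).
  exists (M + 1) => x; rewrite -[l x](subKr (g N x)).
  by rewrite (le_trans (cmodD _ _))// cmodN lerD// gN.
exists (MkCb lCb) => e e0; have [N gN] := gl _ e0; exists N => n Nn.
by apply: Cb_norm_le => [|x]; [exact: ltW|exact: gN].
Qed.

Lemma Cb_normD (f g : Cb) : Cb_norm (f + g) <= Cb_norm f + Cb_norm g.
Proof.
apply: Cb_norm_le => [|x]; first by rewrite addr_ge0 ?Cb_norm_ge0.
by rewrite CbDE (le_trans (cmodD _ _))// lerD// Cb_norm_ub.
Qed.

Lemma Cb_normB (f g : Cb) : Cb_norm (f - g) = Cb_norm (g - f).
Proof.
by congr sup; congr (_ @` _); apply/funext => x; rewrite !CbDE !CbNE cmodB.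
Qed.

Lemma corona_complete (u : nat -> corona_quot) :
  (forall e : R, 0 < e -> exists N : nat, forall m n : nat,
    (N <= m)%N -> (N <= n)%N -> corona_norm (u m - u n) <= e) ->
  exists l, forall e : R, 0 < e -> exists N : nat, forall n : nat,
    (N <= n)%N -> corona_norm (u n - l) <= e.
Proof.
move=> uC; have h0 k : 0 < 2^-1 ^+ k :> R by rewrite exprn_gt0 ?invr_gt0.
have /choice[N uN] k := uC _ (h0 k).
pose M k := (\max_(j < k.+1) N j)%N.
have NM k : (N k <= M k)%N by exact: (leq_bigmax (F := fun j : 'I_k.+1 => N j) ord_max).
have MS k : (M k <= M k.+1)%N.
  by rewrite /M [in leqRHS]big_ord_recr/= leq_maxl.
have vd k : exists d : Cb, corona_pi d = u (M k.+1) - u (M k) /\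
    Cb_norm d <= 2 * 2^-1 ^+ k.
  have dM : (N k <= M k.+1)%N by exact: leq_trans (NM k) (MS k).
  have [d dE dn] := corona_norm_lift (u (M k.+1) - u (M k)) (h0 k).
  exists d; split=> //; apply: (le_trans (ltW dn)); rewrite mulr2n mulrDl mul1r.
  by rewrite lerD2r uN.
have [d dP] := choice vd.
have [g0 g0E] := corona_piP (u (M 0)).
pose g k : Cb := g0 + \sum_(j < k) d j.
have gE k : corona_pi (g k) = u (M k).
  elim: k => [|k IH]; first by rewrite /g big_ord0 addr0.
  by rewrite /g big_ord_recr/= addrA corona_piD IH (dP k).1 addrC subrK.
have gB n k : Cb_norm (g (n + k)%N - g n) <= 4 * 2^-1 ^+ n - 4 * 2^-1 ^+ (n + k).
  elim: k => [|k IH].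
    rewrite addn0 !subrr; apply: Cb_norm_le => // x.
    by rewrite Cb0E cmod0.
  have -> : g (n + k.+1)%N - g n = (g (n + k)%N - g n) + d (n + k)%N.
    have -> : g (n + k.+1)%N = g (n + k)%N + d (n + k)%N.
      by rewrite addnS /g big_ord_recr/= addrA.
    by rewrite addrAC.
  apply: (le_trans (Cb_normD _ _)); rewrite addnS exprSr.
  by have := (dP (n + k)%N).2; lra.
have h4 (e : R) : 0 < e -> exists K : nat, forall k, (K <= k)%N -> 4 * 2^-1 ^+ k <= e.
  move=> e0; have : (4 * 2^-1 ^+ k : R) @[k --> \oo] --> (4 * 0 : R).
    apply: cvgM; first exact: cvg_cst.
    by apply: cvg_expr; rewrite gtr0_norm ?invr_gt0//; lra.
  by rewrite mulr0 => /cvgr_le/(_ _ e0)[K _ hK]; exists K.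
have [l gl] : exists l : Cb, forall e : R, 0 < e -> exists N : nat,
    forall n : nat, (N <= n)%N -> Cb_norm (g n - l) <= e.
  apply: Cb_complete => e e0; have [K hK] := h4 _ e0.
  have gKe n k : (K <= n)%N -> Cb_norm (g (n + k)%N - g n) <= e.
    move=> Kn; apply: (le_trans (gB n k)); have := hK n Kn.
    by have := h0 (n + k)%N; lra.
  exists K => m n Km Kn; have [mn|nm] := leqP m n.
    by rewrite Cb_normB -(subnKC mn) gKe.
  by rewrite -(subnKC (ltnW nm)) gKe.
exists (corona_pi l) => e e0; have e20 : 0 < e / 2 by rewrite divr_gt0.
have [K gK] := gl _ e20; have [L hL] := h4 _ e20.
pose k := maxn K L; exists (M k) => n Mn.
rewrite (_ : u n - _ = (u n - u (M k)) + (u (M k) - corona_pi l)); last first.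
  by rewrite addrA subrK.
rewrite (le_trans (corona_normD _ _))// (splitr e) lerD//.
  have := hL k (leq_maxr _ _); have := h0 k.
  by have := uN k n (M k) (leq_trans (NM k) Mn) (NM k); lra.
rewrite -gE -corona_piN -corona_piD (le_trans (corona_norm_le_lift _))//.
by rewrite gK// leq_maxl.
Qed.

(* Q(C_0(X)) = M(C_0(X)) / C_0(X), where M(C_0(X)) is identified with C_b(X). *)
Definition corona : cstarAlgebra R :=
  @CStarAlgebra R corona_quot corona_mul corona_star corona_norm
    corona_mulA corona_mulDl corona_mulDr corona_mulZl corona_mulZr
    corona_starK corona_starD corona_starZ corona_starM
    corona_norm_ge0 corona_norm0_eq0 corona_normD corona_normZ corona_normM
    corona_norm_cstar corona_complete.

End BoundedFunctions.

(* Main.v *)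
Require Import Defs.
From mathcomp Require Import all_boot all_order all_algebra complex.
From mathcomp Require Import all_classical all_reals topology normedtype.
From mathcomp Require Import numfun lra.

(** Since X is normal, there are a function g equal to 1 on every Y_n and
    functions u_m equal to 1 near Y_0, ..., Y_m and to 0 near the other Y_n,
    with values 0 and 1 only on the support of g.  Choose y_n in Y_n and a
    function b equal to 1 at every y_n whose support meets the region belonging
    to each single Y_n in a relatively compact set.  The conditions
    g x (x - 1) = 0, b x = 0 and g u_n (x - 1) = 0 for all n are finitely
    satisfied by the u_m, because b u_m has compact support.  A realization f
    would be close to {0, 1} on all but finitely many Y_n, close to 0 at y_n
    for large n, and would tend to 1 at infinity along each Y_n, contradicting
    connectedness. *)

Set Implicit Arguments.
Unset Strict Implicit.
Unset Printing Implicit Defensive.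

Import Order.TTheory GRing.Theory Num.Theory.
Import numFieldNormedType.Exports.

Local Open Scope classical_set_scope.
Local Open Scope ring_scope.

(** * Common zeros of terms in a saturated algebra *)

Lemma cstar_norm0 (R : realType) (A : cstarAlgebra R) :
  cstar_norm (0 : A) = 0.
Proof. by rewrite -(scale0r 0) cstar_normZ cmod0 mul0r. Qed.

(** A finite set of conditions |t_k| = 0 involves only indices below some N, so exact common zeros
    of all initial segments give finite approximate satisfiability. *)
Lemma qf_saturated_common_zero (R : realType) (A : cstarAlgebra R) (n : nat)
    (d : 'I_n -> nat) (t : nat -> cstar_term A n) :
  countably_qf_saturated A ->
  (forall N, exists2 x, in_sorts d x &
    forall k, (k < N)%N -> term_eval x (t k) = 0) ->
  exists2 x, in_sorts d x & forall k, term_eval x (t k) = 0.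
Proof.
move=> satA t0; pose c k := (FNorm (t k), 0 : R).
have [||x [dx xS]] := satA n d (range c).
- by apply: card_le_trans (card_image_le _ _) _; exact: card_lexx.
- move=> F Fc finF e e0.
  have /choice[r rP] p : exists k, F p -> p = c k.
    by have [/Fc[k _ <-]|nFp] := pselect (F p); [exists k|exists 0%N].
  have /finite_seqP[s sE] : finite_set (r @` F) by exact: finite_image.
  have [x dx xN] := t0 (\max_(k <- s) k).+1; exists x => // p Fp.
  rewrite (rP p Fp) /= xN ?cstar_norm0 ?subrr ?normr0 ?ltW// ltnS.
  apply: (@leq_bigmax_seq _ s xpredT id) => //.
  by have : (r @` F) (r p) by [exists p]; rewrite sE.
- exists x => // k; apply: cstar_norm0_eq0.
  by apply: (xS (c k)); exists k.
Qed.

(** * Normality and locally finite families of closed sets *)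

Section Topology.
Variable X : topologicalType.

Lemma locally_compact_nbhs (x : X) : locally_compact [set: X] ->
  exists2 K, nbhs x K & compact K /\ closed K.
Proof. by move=> /(_ x I)[U]; rewrite withinET => Ux ?; exists U. Qed.

(** Otherwise the sets [K] minus [U], for [U] open with closure off [B], form a base of a proper
    filter. Regularity at a cluster point gives an open neighbourhood that is itself such a [U], and
    the base set [K] minus it misses it. *)
Lemma regular_compact_separation (K B : set X) : @regular_space X ->
  compact K -> closed B -> K `&` B = set0 ->
  exists U, [/\ open U, K `<=` U & closure U `&` B = set0].
Proof.
move=> regX cK clB KB0; apply: contrapT => noU.
pose P (U : set X) := open U /\ closure U `&` B = set0.
have PU U V : P U -> P V -> P (U `|` V).
  move=> [oU UB] [oV VB]; split; first exact: openU.
  by rewrite closureU setIUl UB VB setU0.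
have P0 : P set0 by split; [exact: open0|rewrite closure0 set0I].
have GP : ProperFilter (filter_from P (fun U => K `\` U)).
  apply: filter_from_proper; last first.
    move=> U [oU UB]; apply/set0P/eqP => KU; apply: noU; exists U; split=> //.
    by rewrite -setD_eq0.
  apply: filter_from_filter; first by exists set0.
  by move=> U V PU_ PV; exists (U `|` V); [exact: PU|rewrite setDUr].
have [|x [Kx clx]] := cK _ GP; first by exists set0 => //; exact: subDsetl.
have [|W Wx WB] := regX x (~` B).
  apply: open_nbhs_nbhs; split; first exact: closed_openC.
  by move=> Bx; rewrite -[False]/(set0 x) -KB0.
have [||z [[_ nWz] Wz]] := clx (K `\` W°) W°; last exact: nWz.
  exists W° => //; split; first exact: open_interior.
  apply/disjoints_subset; apply: subset_trans WB; apply: closureS.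
  exact: interior_subset.
exact: nbhs_interior.
Qed.

(* The countable shrinking argument that makes regular Lindelof spaces normal. *)
Lemma regular_sigma_compact_normal (R : realType) : @regular_space X ->
  sigma_compact X -> normal_space X.
Proof.
move=> regX [K cK KT]; apply/(@normal_openP R) => A B clA clB AB0.
have sep (C D : set X) : closed C -> closed D -> C `&` D = set0 ->
    exists U : nat -> set X, forall n,
    [/\ open (U n), C `&` K n `<=` U n & closure (U n) `&` D = set0].
  move=> clC clD CD0; suff /choice[U UP] n : exists U,
    [/\ open U, C `&` K n `<=` U & closure U `&` D = set0] by exists U.
  apply: regular_compact_separation => //.
    by rewrite setIC; exact: compact_closedI.
  by rewrite setIAC CD0 set0I.
have [U UP] := sep A B clA clB AB0.
have [V VP] := sep B A clB clA (etrans (setIC _ _) AB0).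
have clo (W : nat -> set X) n : closed (\bigcup_(k in `I_n) closure (W k)).
  by apply: closed_bigcup => // k _; exact: closed_closure.
have op (W W' : nat -> set X) : (forall n, open (W n)) ->
    open (\bigcup_n (W n `\` \bigcup_(k in `I_n.+1) closure (W' k))).
  move=> oW; apply: bigcup_open => n _; apply: openI => //.
  exact: closed_openC.
have sub (C : set X) (W W' : nat -> set X) : (forall n, C `&` K n `<=` W n) ->
    (forall n, closure (W' n) `&` C = set0) ->
    C `<=` \bigcup_n (W n `\` \bigcup_(k in `I_n.+1) closure (W' k)).
  move=> CW CW' x Cx; have : [set: X] x by []; rewrite -KT => -[n _ Knx].
  exists n => //; split; first exact: CW.
  by move=> [k _ W'x]; rewrite -[False]/(set0 x) -(CW' k).
exists (\bigcup_n (U n `\` \bigcup_(k in `I_n.+1) closure (V k))).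
exists (\bigcup_n (V n `\` \bigcup_(k in `I_n.+1) closure (U k))); split.
- by apply: op => n; have [] := UP n.
- by apply: op => n; have [] := VP n.
- by apply: sub => n; [have [] := UP n|have [] := VP n].
- by apply: sub => n; [have [] := VP n|have [] := UP n].
rewrite -subset0 => x [[m _ [Ux nVx]] [n _ [Vx nUx]]].
(* Each difference removes closures up to and including its own index, so m = n is covered by the
   first case. *)
have [mn|nm] := leqP m n.
  by apply: nUx; exists m => //; exact: subset_closure.
by apply: nVx; exists n; [exact: ltnW|exact: subset_closure].
Qed.

(** A compact neighbourhood of [x] meets only finitely many [F i], so a limit [x] of the union is
    already a limit of a finite, hence closed, subunion. *)
Lemma locally_finite_bigcup_closed (I : choiceType) (F : I -> set X) :
  locally_compact [set: X] ->
  (forall K, compact K -> finite_set [set i | (K `&` F i) !=set0]) ->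
  (forall i, closed (F i)) -> forall D : set I, closed (\bigcup_(i in D) F i).
Proof.
move=> lcX lfF clF D x Dx; have [K Kx [cK _]] := locally_compact_nbhs x lcX.
pose E := D `&` [set i | (K `&` F i) !=set0].
have clE : closed (\bigcup_(i in E) F i).
  by apply: closed_bigcup => //; apply: finite_setIr; exact: lfF.
suff [i [Di _] Fx] : (\bigcup_(i in E) F i) x by exists i.
apply: clE => V Vx; have [z [[i Di Fz] [Kz Vz]]] := Dx _ (filterI Kx Vx).
by exists z; split=> //; exists i => //; split=> //; exists z.
Qed.

Lemma connected_ivt (R : realType) (A : set X) (f : X -> R) (a b : X) (r : R) :
  connected A -> continuous f -> A a -> A b -> f a <= r <= f b ->
  exists2 x, A x & f x = r.
Proof.
move=> cA cf Aa Ab rab.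
have /connected_intervalP : connected (f @` A).
  by apply: connected_continuous_connected => //; exact: continuous_subspaceT.
by move=> /(_ _ _ (imageP f Aa) (imageP f Ab) r rab)[x Ax fx]; exists x.
Qed.

(** Bands around the separated values 2^-n will provide disjoint neighbourhoods of all the [Y n] at
    once. The prescribed function is continuous on the union because, for each n, the other [Y k]
    have closed union; the Tietze theorem extends it. *)
Lemma bounded_separating_function (R : realType) (Y : nat -> set X) :
  locally_compact [set: X] -> normal_space X -> trivIset [set: nat] Y ->
  (forall n, closed (Y n)) ->
  (forall K, compact K -> finite_set [set n | (K `&` Y n) !=set0]) ->
  exists2 phi : X -> R, continuous phi &
    forall n x, Y n x -> phi x = 2^-1 ^+ n.
Proof.
move=> lcX nX trY clY lfY; have clU := locally_finite_bigcup_closed lcX lfY clY.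
pose A := \bigcup_n Y n.
pose f x : R := 2^-1 ^+ (xget 0%N [set n | Y n x]).
have fY n x : Y n x -> f x = 2^-1 ^+ n.
  move=> Yx; rewrite /f; congr (_ ^+ _).
  case: xgetP => [m _ /= Ymx|/(_ n)//].
  by apply: trY => //; exists x.
have cf : {within A, continuous f}.
  apply/subspace_continuousP => x [n _ Yx].
  apply: cvg_near_cst; rewrite near_withinE.
  apply: (@filterS _ _ _ (~` \bigcup_(k in ~` [set n]) Y k)).
    move=> y ny [m _ Ymy]; have [mn|mn] := eqVneq m n.
      by rewrite /from_subspace (fY n x)// (fY n y)// -mn.
    by exfalso; apply: ny; exists m => //; exact/eqP.
  apply: open_nbhs_nbhs; split; first exact: closed_openC.
  move=> [k kn Ykx]; apply: kn; apply: trY => //; by exists x.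
have f1 x : A x -> `|f x| <= 1.
  move=> [n _ /fY ->]; rewrite ger0_norm; last by rewrite exprn_ge0 ?invr_ge0.
  by rewrite exprn_ile1 ?invr_ge0// invf_le1// ler1n.
have [phi [fphi cphi _]] := continuous_bounded_extension nX (clU _) ltr01 cf f1.
by exists phi => // n x Yx; rewrite -fphi ?inE; [exact: fY|exists n].
Qed.

End Topology.

(** * Bounded continuous functions and their classes in the corona *)

Section BoundedContinuous.
Variables (R : realType) (X : topologicalType).

Lemma normal_urysohn_Cb (A B : set X) : normal_space X ->
  closed A -> closed B -> A `&` B = set0 ->
  exists f : Cb R X, [/\ forall x, A x -> f x = 0, forall x, B x -> f x = 1 &
    forall x, cmod (f x) <= 1].
Proof.
move=> nX clA clB AB0.
have [f [cf fA fB f01]] := urysohn_ext_itv nX clA clB AB0 (@ltr01 R).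
have f1 x : cmod (f x)%:C%C <= 1.
  have := f01 (f x) (imageT f x).
  by rewrite cmod_real /= in_itv/= => /andP[f0 f1]; rewrite ger0_norm.
have fC : (fun x => (f x)%:C%C) \in @Cb_pred R X.
  apply: CbP; last by exists 1.
  move=> x e e0; have /cvgrPdist_lt/(_ _ e0) := cf x.
  by apply: filterS => y; rewrite -rmorphB cmod_real.
exists (MkCb fC); split=> // x.
- by move=> Ax /=; rewrite (fA (f x))//; exists x.
- by move=> Bx /=; rewrite (fB (f x))//; exists x.
Qed.

Lemma continuous_cmod_Cb (f : Cb R X) : continuous (fun x => cmod (f x)).
Proof.
move=> x; apply/cvgrPdist_lt => e e0.
have := Cb_continuous f x e0; apply: filterS => y.
by apply: le_lt_trans; exact: ler_cmodB.
Qed.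

Lemma corona_pi0P (f : Cb R X) : corona_pi f = 0 <-> f \in @C0_pred R X.
Proof.
have -> : 0 = corona_pi (0 : Cb R X).
  by rewrite -(subrr (0 : Cb R X)) corona_piD corona_piN subrr.
by rewrite corona_pi_eq subr0.
Qed.

Lemma C0_support (f : Cb R X) (K : set X) : compact K ->
  (forall x, ~ K x -> f x = 0) -> f \in @C0_pred R X.
Proof.
move=> cK f0; apply/asboolP => e e0; exists K => // x /f0 ->.
by rewrite cmod0.
Qed.

(** The classes of the [u m] all lie in the sort D_1, and [u N] satisfies the first two conditions
    together with the third for every n up to N. *)
Lemma corona_saturated_limit (g b : Cb R X) (u : nat -> Cb R X) :
  countably_qf_saturated (corona R X) ->
  (forall m x, cmod (u m x) <= 1) ->
  (forall m, g * (u m * (u m - 1)) \in @C0_pred R X) ->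
  (forall m, b * u m \in @C0_pred R X) ->
  (forall n m, (n <= m)%N -> g * u n * (u m - 1) \in @C0_pred R X) ->
  exists f : Cb R X, [/\ g * (f * (f - 1)) \in @C0_pred R X,
    b * f \in @C0_pred R X & forall n, g * u n * (f - 1) \in @C0_pred R X].
Proof.
move=> sat u1 gu bu guu; pose Q := corona R X.
pose pi (f : Cb R X) : Q := corona_pi f.
pose x0 : cstar_term Q 1 := TVar Q ord0.
(* Terms have no constant for the unit, so -1 enters as a parameter. *)
pose x1 := TAdd x0 (TPar 1 (pi (-1))).
pose t k := match k with
  | 0%N => TMul (TPar 1 (pi g)) (TMul x0 x1)
  | 1%N => TMul (TPar 1 (pi b)) x0
  | n.+2 => TMul (TPar 1 (pi (g * u n))) x1
  end.
pose h f k := match k with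
  | 0%N => g * (f * (f - 1)) | 1%N => b * f | n.+2 => g * u n * (f - 1) end.
have tE f k : term_eval (fun=> pi f) (t k) = pi (h f k).
  by case: k => [|[|k]] /=; rewrite /pi !(corona_piM, corona_piD).
have [|x _ xt] := qf_saturated_common_zero (d := fun=> 1%N) (t := t) sat.
  move=> N; exists (fun=> pi (u N)) => [i|k kN].
    rewrite (le_trans (corona_norm_le_lift _))//; exact: Cb_norm_le.
  rewrite tE; apply/corona_pi0P; case: k kN => [|[|k]] kN //=.
  by apply: guu; exact: (ltnW (ltnW (ltnW kN))).
have [f fx] := corona_piP (x ord0).
have {}xt k : h f k \in @C0_pred R X.
  apply/corona_pi0P; rewrite -[corona_pi _]/(pi _) -tE -(xt k).
  by rewrite (_ : x = fun=> pi f)//; apply/funext => i; rewrite ord1 -fx.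
by exists f; split=> [||n]; [exact: (xt 0%N)|exact: (xt 1%N)|exact: (xt n.+2)].
Qed.

End BoundedContinuous.

(* For large n, |f (f - 1)| < 1/4 on the whole of Y n, so |f| omits the value
   1/2 there, although it is small at y n and close to 1 far out in Y n. *)
Lemma no_corona_limit (R : realType) (X : topologicalType) (Y : nat -> set X)
    (y : nat -> X) (g b f : Cb R X) (u : nat -> Cb R X) :
  (forall n, closed (Y n)) -> (forall n, connected (Y n)) ->
  (forall n, ~ compact (Y n)) ->
  (forall K, compact K -> finite_set [set n | (K `&` Y n) !=set0]) ->
  (forall n, Y n (y n)) -> (forall n, b (y n) = 1) ->
  (forall n x, Y n x -> g x = 1) -> (forall n x, Y n x -> u n x = 1) ->
  g * (f * (f - 1)) \in @C0_pred R X -> b * f \in @C0_pred R X ->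
  (forall n, g * u n * (f - 1) \in @C0_pred R X) -> False.
Proof.
move=> clY conY ncY lfY Yy by1 gY uY /asboolP gf /asboolP bf guf.
have [|K cK gK] := gf (4^-1); first by rewrite invr_gt0.
have [|L cL bL] := bf (2^-1); first by rewrite invr_gt0.
(* Only finitely many [Y n] meet the compact exceptional set, so some [Y n] avoids it. *)
have [n nKL] : exists n, ~ (((K `|` L) `&` Y n) !=set0).
  apply: contrapT => /forallNP KLY; apply: infinite_nat.
  apply: sub_finite_set (lfY _ (compactU cK cL)) => n _ /=.
  by apply: contrapT; exact: KLY.
have KLn x : Y n x -> ~ K x /\ ~ L x.
  by move=> Yx; split=> Z; apply: nKL; exists x; split=> //; [left|right].
have /asboolP/(_ (2^-1))[|M cM guM] := guf n; first by rewrite invr_gt0.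
(* A closed subset of the compact [M] would be compact. *)
have [z Yz nMz] : exists2 z, Y n z & ~ M z.
  apply: contrapT => H; apply: (ncY n); apply: subclosed_compact cM _ => //.
  by move=> z Yz; apply: contrapT => nMz; apply: H; exists z.
have fy : cmod (f (y n)) < 2^-1.
  by have := bL _ (KLn _ (Yy n)).2; rewrite CbME by1 mul1r.
have fz : 2^-1 <= cmod (f z).
  have := guM z nMz; rewrite !CbME (gY n)// (uY n)// !mul1r.
  rewrite CbDE CbNE Cb1E cmodB; have := cmodD (1 - f z) (f z).
  by rewrite subrK cmod1; lra.
have [|x Yx fx] := connected_ivt (r := 2^-1) (conY n)
    (@continuous_cmod_Cb _ _ f) (Yy n) Yz.
  by rewrite (ltW fy).
(* |f x| = 1/2 forces |f x - 1| >= 1/2, so the product has modulus at least 1/4. *)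
have := gK x (KLn x Yx).1; rewrite !CbME (gY n)// mul1r cmodM fx.
rewrite CbDE CbNE Cb1E cmodB; have := cmodD (1 - f x) (f x).
by rewrite subrK cmod1 fx; lra.
Qed.

(** * Construction of [g], [b] and [u] from the sets [Y n] *)

Theorem theorem2p1 (R : realType) (X : topologicalType)
  (X_hausdorff : hausdorff_space X)
  (X_locally_compact : locally_compact [set: X])
  (X_sigma_compact : sigma_compact X)
  (Y : nat -> set X)
  (Y_disjoint : trivIset [set: nat] Y)
  (Y_closed : forall n : nat, closed (Y n))
  (Y_connected : forall n : nat, connected (Y n))
  (Y_noncompact : forall n : nat, ~ compact (Y n))
  (Y_locally_finite : forall K : set X, compact K ->
     finite_set [set n : nat | (K `&` Y n) !=set0]) :
  ~ countably_qf_saturated (corona R X).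
Proof.
move=> sat.
have regX : @regular_space X.
  apply: (@completely_regular_regular R).
  exact: (@locally_compact_completely_regular _ R).
have nX := regular_sigma_compact_normal R regX X_sigma_compact.
have clU := locally_finite_bigcup_closed X_locally_compact Y_locally_finite
  Y_closed.
have [phi cphi phiY] := bounded_separating_function R X_locally_compact nX
  Y_disjoint Y_closed Y_locally_finite.
pose h n : R := 2^-1 ^+ n.
have h0 n : 0 < h n by rewrite exprn_gt0 ?invr_gt0.
have hS n : h n.+1 = h n / 2 by rewrite /h exprSr.
have hle m n : (m <= n)%N -> h n <= h m.
  by move=> mn; rewrite ler_wiXn2l ?invr_ge0// invf_le1// ler1n.
(* Since 5/4 h(m+1) = 5/8 h(m) < 3/4 h(m), these bands are disjoint, and [u m] can pass from 0 to 1
   in the gap between bands m+1 and m. *)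
pose O n := phi @^-1` `]3 / 4 * h n, 5 / 4 * h n[.
have oO n : open (O n) by apply: open_comp => // x _; exact: cphi.
have YO n : Y n `<=` O n.
  move=> x /phiY; rewrite /O /= in_itv/= -/(h n) => ->.
  by have := h0 n; lra.
have Ohi m n x : O n x -> (n <= m)%N -> 3 / 4 * h m <= phi x.
  by rewrite /O /= in_itv/= => /andP[+ _] /hle; lra.
have Olo m n x : O n x -> (m < n)%N -> phi x <= 5 / 8 * h m.
  by rewrite /O /= in_itv/= => /andP[_ +] /hle; rewrite hS; lra.
have /choice[u uP] m : exists u : Cb R X,
    [/\ forall x, phi x <= 5 / 8 * h m -> u x = 0,
        forall x, 3 / 4 * h m <= phi x -> u x = 1 & forall x, cmod (u x) <= 1].
  apply: (normal_urysohn_Cb R (A := phi @^-1` [set r | r <= 5 / 8 * h m])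
    (B := phi @^-1` [set r | 3 / 4 * h m <= r])) => //.
  - by apply: closed_comp => [x _|]; [exact: cphi|exact: closed_le].
  - by apply: closed_comp => [x _|]; [exact: cphi|exact: closed_ge].
  - by rewrite -subset0 => x [/= ? ?]; have := h0 m; lra.
have u1 m n x : O n x -> (n <= m)%N -> u m x = 1.
  by have [_ + _] := uP m; move=> um1 Ox nm; apply: um1; exact: Ohi Ox nm.
have u0 m n x : O n x -> (m < n)%N -> u m x = 0.
  by have [+ _ _] := uP m; move=> um0 Ox mn; apply: um0; exact: Olo Ox mn.
(* Applied to the [Y n] inside the [O n] for [g], and to the points [y n] inside the [W n] for
   [b]. *)
have sep (A : set X) (W : nat -> set X) : closed A -> (forall n, open (W n)) ->
    A `<=` \bigcup_n W n -> exists g : Cb R X,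
    (forall x, A x -> g x = 1) /\ forall x, (forall n, ~ W n x) -> g x = 0.
  move=> clA oW AW; have [|||g [g0 g1 _]] :=
      @normal_urysohn_Cb R X (~` \bigcup_n W n) A nX => //.
  - by apply: open_closedC; exact: bigcup_open.
  - by rewrite setIC; apply/disjoints_subset; rewrite setCK.
  exists g; split=> // x nWx; apply: g0 => -[n _]; exact: nWx.
have [g [gY g0]] := sep (\bigcup_n Y n) O (clU _) oO
  (subset_bigcup (fun n _ => YO n)).
have /choice[y Yy] n : exists y, Y n y.
  apply: contrapT => /forallNP Yn0; apply: (Y_noncompact n).
  have -> : Y n = set0 by rewrite -subset0 => z /Yn0.
  exact: compact0.
have /choice[W WP] n : exists W : set X, [/\ open W, W (y n), W `<=` O n &
    exists2 K, compact K & W `<=` K].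
  have [K Ky [cK _]] := locally_compact_nbhs (y n) X_locally_compact.
  exists (O n `&` K°); split=> //.
  - by apply: openI => //; exact: open_interior.
  - by split; [exact/YO/Yy|exact: Ky].
  - by exists K => // x [_]; exact: interior_subset.
(* A compact set containing [y n] meets [Y n], so the points inherit local finiteness from the
   sets. *)
have cly : closed (\bigcup_n [set y n]).
  apply: locally_finite_bigcup_closed => // [K cK|n].
    apply: sub_finite_set (Y_locally_finite K cK) => n [x [Kx /= xy]].
    by exists x; split=> //; rewrite xy.
  exact/accessible_closed_set1/hausdorff_accessible.
have [||b [by1 b0]] := sep _ W cly.
- by move=> n; have [] := WP n.
- by move=> x [n _ ->]; exists n => //; have [] := WP n.
(* As [g] vanishes off the bands, products with [g] need checking only on the [O n], where each
   [u m] is constantly 0 or 1. *)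
have gO x (v : R[i]) : (forall n, O n x -> v = 0) -> g x * v = 0.
  move=> v0; have [[n On]|/forallNP nO] := pselect (exists n, O n x).
    by rewrite (v0 n)// mulr0.
  by rewrite g0// mul0r.
have C00 : (0 : Cb R X) \in @C0_pred R X by exact: rpred0.
have [||||f [gf bf guf]] :=
  corona_saturated_limit (g := g) (b := b) (u := u) sat.
- by move=> m; have [] := uP m.
- move=> m; rewrite (_ : g * _ = 0)//; apply: Cb_eq => x.
  rewrite !CbME CbDE CbNE Cb1E; apply: gO => n On.
  have [nm|mn] := leqP n m; first by rewrite (u1 _ n)// subrr mulr0.
  by rewrite (u0 _ n)// mul0r.
(* [b] lives on the [W n], and [u m] kills those with n > m; the remaining m+1 lie in compact
   sets. *)
- move=> m; have /choice[K KP] n : exists K, compact K /\ W n `<=` K.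
    by have [_ _ _ [K ? ?]] := WP n; exists K.
  apply: (@C0_support _ _ _ (\big[setU/set0]_(n < m.+1) K n)).
    by apply: bigsetU_compact => n _; have [] := KP n.
  move=> x nKx; rewrite CbME.
  have [[n Wn]|/forallNP nW] := pselect (exists n, W n x); last first.
    by rewrite b0// mul0r.
  rewrite (u0 m n) ?mulr0//; first by have [_ _ + _] := WP n; exact.
  rewrite ltnNge; apply/negP => nm; apply: nKx.
  rewrite -bigcup_mkord; exists n; rewrite /= ?ltnS//.
  by have [_] := KP n; exact.
- move=> n m nm; rewrite (_ : g * _ * _ = 0)//; apply: Cb_eq => x.
  (* On band k, [u m] is 1 if k <= n <= m, while [u n] is 0 if k > n. *)
  rewrite !CbME CbDE CbNE Cb1E -mulrA; apply: gO => k Ok.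
  have [kn|nk] := leqP k n; last by rewrite (u0 _ k)// mul0r.
  by rewrite (u1 m k) ?subrr ?mulr0//; exact: leq_trans kn nm.
apply: (no_corona_limit Y_closed Y_connected Y_noncompact Y_locally_finite
  Yy _ _ _ gf bf guf).
- by move=> n; apply: by1; exists n.
- by move=> n x Yx; apply: gY; exists n.
- by move=> n x /YO Ox; exact: u1 Ox _.
Qed.
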